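(* For any finite simple graph $G$ with no isolated vertex, $$\gamma_{\times 2}(G)\leq \alpha(G)+\gamma(G),$$ where $\gamma_{\times 2}(G)$ is the double domination number, $\alpha(G)$ the independence number and $\gamma(G)$ the domination number of $G$.
   Context: Graphs are finite and simple. For a vertex $v\in V(G)$, the open neighbourhood is $N(v)=\{u\in V(G): u \text{ is adjacent to } v\}$ and the closed neighbourhood is $N[v]=N(v)\cup\{v\}$. A set $D\subseteq V(G)$ is a dominating set if $|D\cap N[v]|\ge 1$ for every $v\in V(G)$; the domination number $\gamma(G)$ is the minimum cardinality of a dominating set. A set $D\subseteq V(G)$ is a double dominating set (2-tuple dominating set) if $|D\cap N[v]|\ge 2$ for every $v\in V(G)$ (including the vertices of $D$); the double domination number $\gamma_{\times 2}(G)$ is the minimum cardinality of a double dominating set. The independence number $\alpha(G)$ is the maximum cardinality of a set of pairwise non-adjacent vertices of $G$. *)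

(* Defs.v *)
From mathcomp Require Import all_boot.

Set Implicit Arguments.
Unset Strict Implicit.
Unset Printing Implicit Defensive.

(* A finite simple graph is a symmetric irreflexive relation e on a finType. *)
Section Graph.
Variables (T : finType) (e : rel T).

Definition open_nbhd (v : T) : {set T} := [set u | e v u].

Definition closed_nbhd (v : T) : {set T} := v |: open_nbhd v.

Definition isolated (v : T) : bool := open_nbhd v == set0.

Definition independent (S : {set T}) : bool :=
  [forall u in S, forall v in S, ~~ e u v].

Definition dominating (D : {set T}) : bool :=
  [forall v, 1 <= #|D :&: closed_nbhd v|].

Definition double_dominating (D : {set T}) : bool :=
  [forall v, 2 <= #|D :&: closed_nbhd v|].

Lemma dominating_setT : dominating setT.
Proof.
by apply/forallP => v; rewrite setTI card_gt0; apply/set0Pn; exists v; rewrite setU11.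
Qed.

Lemma double_dominating_setT :
  irreflexive e -> (forall v, ~~ isolated v) -> double_dominating setT.
Proof.
move=> eI noiso; apply/forallP => v.
by rewrite setTI cardsU1 inE eI ltnS card_gt0 noiso.
Qed.

Definition independence_number : nat := \max_(S | independent S) #|S|.

Definition domination_number : nat :=
  #|[arg min_(D < [set: T] | dominating D) #|D|]|.

(* This is the minimum only when a double dominating set exists, i.e. when
   there is no isolated vertex (double_dominating_setT); otherwise it is #|T|. *)
Definition double_domination_number : nat :=
  #|[arg min_(D < [set: T] | double_dominating D) #|D|]|.

End Graph.

(* Main.v *)
Require Import Defs.
From mathcomp Require Import all_boot.

Set Implicit Arguments.
Unset Strict Implicit.
Unset Printing Implicit Defensive.

(** Start from a dominating set [D] and a maximal independent subset [I] of its
    complement.  A vertex outside [D :|: I] has a neighbour in [D] (domination)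
    and one in [I] (maximality); a vertex of [I] is counted itself and has a
    neighbour in [D].  Hence [D :|: I] can fail to be double dominating only at
    the set [L] of the vertices of [D] with no neighbour in [D :|: I].  Adding
    one neighbour of each vertex of [L] repairs this at a cost of at most
    [#|L|].  This costs no more than the independence number allows, because
    [I :|: L] is itself independent: [L] has no edge to [D], which contains [L],
    and none to [I].  So the double dominating set obtained has at most
    [#|D| + #|I| + #|L| <= #|D| + independence_number e] elements. *)

Section DoubleDomination.
Variables (T : finType) (e : rel T).
Hypotheses (e_sym : symmetric e) (e_irr : irreflexive e).

Lemma independentP (S : {set T}) :
  reflect {in S &, forall u v, ~~ e u v} (independent e S).
Proof.
apply: (iffP forall_inP) => [indS u v uS vS | indS u uS].
  exact: (forall_inP (indS u uS)).
by apply/forall_inP => v; apply: indS.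
Qed.

Lemma leq_independence_number (S : {set T}) :
  independent e S -> #|S| <= independence_number e.
Proof. exact: (@leq_bigmax_cond _ _ (fun S : {set T} => #|S|)). Qed.

Lemma double_domination_number_leq (S : {set T}) :
  (forall v, ~~ isolated e v) -> double_dominating e S ->
  double_domination_number e <= #|S|.
Proof.
move=> noiso ddS; rewrite /double_domination_number.
case: arg_minnP => [|M _ minM]; last exact: minM.
exact: double_dominating_setT.
Qed.

Lemma domination_number_attained :
  exists2 D, dominating e D & #|D| = domination_number e.
Proof.
rewrite /domination_number; case: arg_minnP => [|D domD _].
  exact: dominating_setT.
by exists D.
Qed.

Lemma dominating_neighbour (D : {set T}) v :
  dominating e D -> v \notin D -> exists2 u, u \in D & e v u.
Proof.
move=> /forallP/(_ v); rewrite card_gt0 => /set0Pn[u].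
rewrite !inE => /andP[uD /predU1P[eq_uv | evu]]; last by exists u.
by rewrite -eq_uv uD.
Qed.

Lemma exists_neighbour v : ~~ isolated e v -> exists u, e v u.
Proof. by case/set0Pn => u; rewrite inE; exists u. Qed.

Lemma independentU (A B : {set T}) :
  independent e A -> independent e B -> {in A & B, forall u v, ~~ e u v} ->
  independent e (A :|: B).
Proof.
move=> /independentP indA /independentP indB indAB.
apply/independentP => u v /setUP[uA|uB] /setUP[vA|vB].
- exact: indA.
- exact: indAB.
- by rewrite e_sym indAB.
- exact: indB.
Qed.

Lemma independent1 v : independent e [set v].
Proof. by apply/independentP => x y /set1P-> /set1P->; rewrite e_irr. Qed.

(** A maximal independent subset of [A] works: a vertex of [A] outside it and
    with no neighbour in it could be added to it. *)
Lemma independent_dominating_subset (A : {set T}) :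
  exists I : {set T}, [/\ I \subset A, independent e I
    & {in A, forall v, v \notin I -> exists2 u, u \in I & e v u}].
Proof.
have [|I /maxsetP[/andP[sIA indI] maxI] _] :=
    @maxset_exists _ [pred S : {set T} | (S \subset A) && independent e S] set0.
  rewrite /= sub0set; apply/independentP => u v; by rewrite inE.
exists I; split=> // v vA vI; apply/exists_inP; apply: contraNT vI => noI.
rewrite -(maxI (v |: I)) ?setU11 ?subsetUr //=.
rewrite subUset sub1set vA sIA independentU ?independent1 // => x y /set1P-> yI.
by apply: contra noI => evy; apply/exists_inP; exists y.
Qed.

Lemma double_dominatingP (S : {set T}) :
  (forall v, v \in S -> exists2 u, u \in S & e v u) ->
  (forall v, v \notin S ->
     exists u w, [/\ u \in S, w \in S, u != w, e v u & e v w]) ->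
  double_dominating e S.
Proof.
move=> inS outS; apply/forallP => v; apply/card_gt1P.
have [vS|vS] := boolP (v \in S).
  have [u uS evu] := inS v vS.
  exists v, u; rewrite !inE eqxx vS uS evu orbT; split=> //.
  by apply: contraTneq evu => <-; rewrite e_irr.
have [u [w [uS wS neq_uw evu evw]]] := outS v vS.
by exists u, w; rewrite !inE uS wS evu evw !orbT.
Qed.

(** The set [D :|: I] needs repair only at [L], and [D] already pays for [#|D|];
    the independence number has to pay for both [I] and the repair, which it can
    because [I] and [L] are disjoint with an independent union. *)
Lemma dominating_extend_double (D : {set T}) :
  (forall v, ~~ isolated e v) -> dominating e D ->
  exists2 S, double_dominating e S & #|S| <= independence_number e + #|D|.
Proof.
move=> noiso domD.
have [I [sID indI domI]] := independent_dominating_subset (~: D).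
have notD v : v \in I -> v \notin D by move/(subsetP sID); rewrite inE.
pose L := [set v in D | [forall u in D :|: I, ~~ e v u]].
have L_D v : v \in L -> v \in D by rewrite inE => /andP[].
have L_lonely v u : v \in L -> u \in D :|: I -> ~~ e v u.
  by rewrite inE => /andP[_ /forall_inP]; apply.
pose f v := odflt v [pick u | e v u].
have ef v : e v (f v).
  rewrite /f; case: pickP => //= no_nbr.
  by have [u] := exists_neighbour (noiso v); rewrite no_nbr.
have indIL : independent e (I :|: L).
  apply: independentU => // [|u v uI vL].
    apply/independentP => u v uL vL.
    by apply: L_lonely => //; rewrite inE L_D.
  by rewrite e_sym; apply: L_lonely => //; rewrite inE uI orbT.
have disjIL : [disjoint I & L].
  rewrite disjoints_subset; apply/subsetP => v /notD vD.
  by rewrite inE; apply: contra vD; apply: L_D.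
exists (D :|: I :|: f @: L); last first.
  apply: leq_trans (leq_card_setU _ _).1 _.
  apply: leq_trans (leq_add (leq_card_setU _ _).1 (leq_imset_card _ _)) _.
  have -> : #|D| + #|I| + #|L| = #|I :|: L| + #|D|.
    by rewrite cardsU (disjoint_setI0 disjIL) cards0 subn0 -addnA addnC.
  by rewrite leq_add2r leq_independence_number.
have D_S v : v \in D -> v \in D :|: I :|: f @: L by rewrite !inE => ->.
have I_S v : v \in I -> v \in D :|: I :|: f @: L.
  by rewrite !inE => ->; rewrite orbT.
apply: double_dominatingP => v.
  have [vD _|vD _] := boolP (v \in D).
    have [vL|] := boolP (v \in L).
      by exists (f v); rewrite ?ef // inE imset_f ?orbT.
    rewrite inE vD /= negb_forall_in => /exists_inP[u uDI /negPn evu].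
    by exists u => //; rewrite inE uDI.
  by have [u uD evu] := dominating_neighbour domD vD; exists u => //; apply: D_S.
rewrite !inE !negb_or -andbA => /and3P[vD vI _].
have [u uD evu] := dominating_neighbour domD vD.
have [|w wI evw] := domI v _ vI; first by rewrite inE.
exists u, w; split=> //; [exact: D_S | exact: I_S |].
by apply: contraTneq uD => ->; apply: notD.
Qed.

End DoubleDomination.

Theorem theorem2p2 (T : finType) (e : rel T)
    (e_sym : symmetric e) (e_irr : irreflexive e)
    (no_isolated : forall v : T, ~~ isolated e v) :
  double_domination_number e <= independence_number e + domination_number e.
Proof.
have [D domD <-] := domination_number_attained e.
have [S ddS leS] := dominating_extend_double e_sym e_irr no_isolated domD.
exact: leq_trans (double_domination_number_leq e_irr no_isolated ddS) leS.
Qed.
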